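(* Let $I\subseteq\mathbb{R}$ be a nonempty open interval and let $f:I\to\mathbb{R}$ be a function. Let $\lambda_1,\lambda_2,\lambda_3\in[0,1]$ be such that $\lambda_1+\lambda_2+\lambda_3=1$. (i) With $\omega_3:=\mathrm{e}^{\frac{2\pi}{3}\mathrm{i}}$, the condition $$\sum_{j=1}^3\lambda_j\omega_3^{k(j-1)}\neq0\quad\text{for all } k\in\{1,2\}$$ is equivalent to the condition that $\lambda_1,\lambda_2,\lambda_3$ are not all equal to each other (i.e., not all of them are equal to $\frac13$). (ii) If $\lambda_1,\lambda_2,\lambda_3$ are not all equal to each other and the inequality $$f\left(\frac{x_1+x_2+x_3}{3}\right)\leq\frac13\Big(f(\lambda_1x_1+\lambda_2x_2+\lambda_3x_3)+f(\lambda_2x_1+\lambda_3x_2+\lambda_1x_3)+f(\lambda_3x_1+\lambda_1x_2+\lambda_2x_3)\Big)$$ holds for all $x_1,x_2,x_3\in I$, then $f$ is Jensen convex on $I$.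
   Context: $\mathrm{i}$ is the imaginary unit. A function $f:I\to\mathbb{R}$ is Jensen convex on $I$ if $f\left(\frac{x+y}{2}\right)\leq\frac{f(x)+f(y)}{2}$ for all $x,y\in I$. *)

(* Defs.v *)
From mathcomp Require Import all_boot all_order all_algebra.
From mathcomp Require Import complex.
From mathcomp Require Import all_classical all_reals all_analysis.

Set Implicit Arguments.
Unset Strict Implicit.
Unset Printing Implicit Defensive.

Import Order.TTheory GRing.Theory Num.Theory.
Import numFieldNormedType.Exports.

Local Open Scope ring_scope.
Local Open Scope complex_scope.
Local Open Scope classical_set_scope.

(* The complex exponential, as the sum of its power series; this mirrors the
   definition of [expR]. The limit is taken for the modulus topology of R[i],
   which is carried by the alias R[i]^o. *)
Definition cexp (R : realType) (z : R[i]) : R[i] :=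
  limn (series (fun n : nat => z ^+ n / (n`!)%:R) : nat -> R[i]^o).

Definition omega3 (R : realType) : R[i] :=
  cexp ((2 * pi / 3)%:C * 'i%C).

(* A function on the interval I is represented by a total function on R of
   which only the values on I are used. *)
Definition jensen_convex (R : realType) (I : set R) (f : R -> R) : Prop :=
  forall x y : R, I x -> I y -> f ((x + y) / 2) <= (f x + f y) / 2.

(* Main.v *)
Require Import Defs.
From mathcomp Require Import all_boot all_order all_algebra.
From mathcomp Require Import complex.
From mathcomp Require Import all_classical all_reals all_analysis.
From mathcomp Require Import ring lra.

(** Part (i).  Separating real and imaginary parts in the power series of the
    exponential gives Euler's formula, and the triple angle formula at [pi / 3]
    then yields [omega3 = - 1/2 + s i] with [s ^+ 2 = 3/4].  The sums in question
    are therefore [l1 - (l2 + l3) / 2 +/- s (l2 - l3) i], and such a number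
    vanishes exactly when [l2 = l3] and [l1 = (l2 + l3) / 2].

    Part (ii).  Let [C] be the circulant matrix that maps [(x1, x2, x3)] to the
    three arguments on the right-hand side of the inequality.  It preserves
    sums, and it is invertible because its determinant is [- D], where
    [D = l1^2 + l2^2 + l3^2 - l1 l2 - l2 l3 - l3 l1 > 0].  Hence every triple
    [(p - h, p + h, p)] with [h] small is the image under [C] of a triple of
    points of [I], and the inequality reads
    [f p <= (f (p - h) + f (p + h) + f p) / 3], that is,
    [2 f p <= f (p - h) + f (p + h)].  This is Jensen convexity for small steps
    only ([circulant_midpoint]), but on a segment between two points of [I] the
    size of the admissible steps is uniform.  Cutting the segment into equal
    short pieces gives a sequence with nonnegative second differences, and such
    a sequence is midpoint convex at any distance ([midpoint_of_small_steps]). *)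

Set Implicit Arguments.
Unset Strict Implicit.
Unset Printing Implicit Defensive.

Import Order.TTheory GRing.Theory Num.Theory.
Import numFieldNormedType.Exports.

Local Open Scope ring_scope.
Local Open Scope complex_scope.
Local Open Scope classical_set_scope.

(** * The cube root of unity *)

Lemma cvg_real_complex (R : realType) (u : nat -> R) (a : R) :
  u n @[n --> \oo] --> a ->
  ((u n)%:C : R[i]^o) @[n --> \oo] --> (a%:C : R[i]^o).
Proof.
move=> /cvgrPdist_lt ua; apply/cvgrPdist_lt => e; rewrite ltcE /= => /andP[/eqP Ime e0].
apply: filterS (ua _ e0) => n; rewrite -rmorphB normc_def /= expr0n /= addr0.
by rewrite sqrtr_sqr ltcE /= Ime eqxx.
Qed.

Lemma cexp_coeffE (R : realType) (t : R) (n : nat) :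
  (t%:C * 'i%C) ^+ n / n`!%:R =
  (cos_coeff t n)%:C + (sin_coeff t n)%:C * 'i%C :> R[i].
Proof.
have i2k k : 'i%C ^+ k.*2 = ((-1) ^+ k)%:C :> R[i].
  by rewrite -mul2n exprM sqr_i rmorphXn rmorphN rmorph1.
have -> : n`!%:R = (n`!%:R)%:C :> R[i] by rewrite rmorph_nat.
rewrite exprMn -rmorphXn /cos_coeff /sin_coeff -fmorphV.
rewrite -[in 'i%C ^+ n](odd_double_half n) exprD i2k.
case: (boolP (odd n)) => on /=.
  have -> : n.-1./2 = n./2.
    by rewrite -[in LHS](odd_double_half n) on add1n /= doubleK.
  rewrite on !mul0r rmorph0 add0r expr1 mul1r !rmorphM /=.
  by ring.
rewrite (negPf on) !mul0r addr0 expr0 !mul1r -exprnP !rmorphM /=.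
by ring.
Qed.

(** The partial sums of the exponential series at [t i] split exactly into
    those of the cosine and sine series, so the limits can be added. *)
Lemma cexp_imaginary (R : realType) (t : R) :
  cexp (t%:C * 'i%C) = (cos t)%:C + (sin t)%:C * 'i%C.
Proof.
have cc : (fun n => (series (cos_coeff t) n)%:C : R[i]^o) @ \oo --> ((cos t)%:C : R[i]^o).
  by apply: cvg_real_complex; rewrite unlock; exact: is_cvg_series_cos_coeff.
have cs : (fun n => (series (sin_coeff t) n)%:C : R[i]^o) @ \oo --> ((sin t)%:C : R[i]^o).
  by apply: cvg_real_complex; rewrite unlock; exact: is_cvg_series_sin_coeff.
(* The product by [i] is taken as a scalar action, because the topology is
   that of the normed module [R[i]^o]. *)
have csi : (fun n => 'i%C *: ((series (sin_coeff t) n)%:C : R[i]^o)) @ \oo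
    --> ('i%C *: ((sin t)%:C : R[i]^o)).
  exact: (cvgZl_tmp (V := R[i]^o)).
rewrite /cexp [_ * 'i%C in RHS]mulrC.
refine (etrans _ (@cvg_lim R[i]^o (@norm_hausdorff _ R[i]^o) _ _ _ _ _
  (@cvgD _ R[i]^o _ _ _ _ _ _ _ cc csi))).
congr (limn _); apply/funext => n.
rewrite -[RHS]/((series (cos_coeff t) n)%:C + 'i%C * (series (sin_coeff t) n)%:C).
rewrite /series /= !rmorph_sum /= mulr_sumr -big_split /=.
by apply: eq_bigr => k _; rewrite cexp_coeffE [_ * 'i%C]mulrC.
Qed.

(** [cos pi = -1] and the triple angle formula make [c := cos (pi / 3)] a root of
    [4 c^3 - 3 c + 1 = (c + 1) (2 c - 1)^2], and [c] is positive. *)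
Lemma cos_pi3 (R : realType) : cos (pi / 3) = 1 / 2 :> R.
Proof.
have pi0 := pi_gt0 R.
have c0 : 0 < cos (pi / 3 : R) by apply: cos_gt0_pihalf; apply/andP; split; lra.
have := cospi R.
have {1}-> : pi = pi / 3 *+ 2 + pi / 3 :> R by field.
rewrite cosD cos_mulr2n sin_mulr2n.
have := cos2Dsin2 (pi / 3 : R).
move: (cos _) (sin _) c0 => c s c0 cs e.
have : (c + 1) * (2 * c - 1) ^+ 2 = 0.
  have s2 : s ^+ 2 = 1 - c ^+ 2 by rewrite -cs addrC addKr.
  have : (c ^+ 2 *+ 2 - 1) * c - 2 * c * s ^+ 2 = -1 by rewrite -[RHS]e; ring.
  by rewrite s2; lra.
by move/eqP; rewrite mulf_eq0 sqrf_eq0 => /orP[] /eqP ?; lra.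
Qed.

Lemma omega3E (R : realType) :
  exists2 s : R, s ^+ 2 = 3 / 4 & omega3 R = (- (1 / 2)) +i* s.
Proof.
have cE : cos (2 * pi / 3) = - (1 / 2) :> R.
  have -> : 2 * pi / 3 = pi / 3 *+ 2 :> R by field.
  by rewrite cos_mulr2n cos_pi3; field.
exists (sin (2 * pi / 3)); first by rewrite sin2cos2 cE; field.
by rewrite /omega3 cexp_imaginary cE; simpc.
Qed.

Lemma cubic_sums_neq0 (R : realType) (l1 l2 l3 : R) :
  (forall k : nat, k \in [:: 1%N; 2%N] ->
     \sum_(1 <= j < 4)
       ([:: l1; l2; l3]`_(j - 1))%:C * omega3 R ^+ (k * (j - 1)) != 0)
  <-> ~ (l1 = l2 /\ l2 = l3).
Proof.
have [s s2 ->] := omega3E R.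
set w := _ +i* s.
have wsq (e : R) : e ^+ 2 = 3 / 4 ->
    ((- (1 / 2)) +i* e) ^+ 2 = (- (1 / 2)) +i* (- e) :> R[i].
  rewrite !expr2 => e2; simpc; rewrite e2.
  by apply/eqP; rewrite eq_complex /=; apply/andP; split; apply/eqP; field.
have w2 : w ^+ 2 = (- (1 / 2)) +i* (- s) by exact: wsq.
have w4 : w ^+ 4 = w.
  by rewrite -[4%N]/(2 * 2)%N exprM w2 wsq ?sqrrN // opprK.
have sumE k : \sum_(1 <= j < 4) ([:: l1; l2; l3]`_(j - 1))%:C * w ^+ (k * (j - 1))
    = l1%:C + l2%:C * w ^+ k + l3%:C * w ^+ (k * 2).
  rewrite big_nat_recr // big_nat_recr // big_nat_recr // big_geq //=.
  by rewrite add0r subnn muln0 expr0 mulr1 (muln1 k).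
have s0 : s != 0.
  by apply/eqP => s0; move: s2; rewrite s0 expr0n /=; lra.
(* [k = 1] and [k = 2] differ by complex conjugation of the powers of [w], that
   is, by the sign of the imaginary part [e]. *)
have sumk k (e : R) : e != 0 -> w ^+ k = (- (1 / 2)) +i* e ->
    w ^+ (k * 2) = (- (1 / 2)) +i* (- e) ->
    l1%:C + l2%:C * w ^+ k + l3%:C * w ^+ (k * 2) = 0 <-> l1 = l2 /\ l2 = l3.
  move=> e0 -> ->; simpc; split => [/eqP|[-> ->]].
    rewrite eq_complex /= => /andP[/eqP re /eqP im].
    have : (l2 - l3) * e = 0 by rewrite -im; ring.
    move/eqP; rewrite mulf_eq0 (negPf e0) orbF subr_eq0 => /eqP l23.
    by split; lra.
  by apply/eqP; rewrite eq_complex /=; apply/andP; split; apply/eqP; field.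
have sum1 := sumk 1%N s s0 (expr1 w) w2.
have sum2 : _ <-> _ := sumk 2%N (- s) _ w2 _.
split=> [/(_ 1%N (mem_head _ _)) + /sum1 e|l k].
  by rewrite sumE e eqxx.
rewrite sumE !inE => /orP[] /eqP ->; apply/eqP => e; apply: l; first exact/sum1.
by apply/sum2; rewrite ?oppr_eq0 ?opprK // w4.
Qed.

(** * From small steps to Jensen convexity *)

(** For [b j := f (m + j d) + f (m - j d)], adding the two hypotheses gives
    [b (j + 1) - b j >= b j - b (j - 1)], so that [b] is nondecreasing. *)
Lemma midpoint_of_small_steps (R : realFieldType) (f : R -> R) (m d : R) (n : nat) :
  (forall j, (j < n)%N ->
     2 * f (m + j%:R * d) <= f (m + j%:R * d - d) + f (m + j%:R * d + d) /\
     2 * f (m - j%:R * d) <= f (m - j%:R * d - d) + f (m - j%:R * d + d)) ->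
  2 * f m <= f (m - n%:R * d) + f (m + n%:R * d).
Proof.
move=> fj; pose b j := f (m - j%:R * d) + f (m + j%:R * d).
have Sm j : m - j.+1%:R * d = m - j%:R * d - d by rewrite -natr1; ring.
have Sp j : m + j.+1%:R * d = m + j%:R * d + d by rewrite -natr1; ring.
have Pm j : m - j.+1%:R * d + d = m - j%:R * d by rewrite Sm subrK.
have Pp j : m + j.+1%:R * d - d = m + j%:R * d by rewrite Sp addrK.
have step j : (j < n)%N -> b j <= b j.+1.
  elim: j => [|j IH] jn.
    by rewrite /b Sm Sp; have := fj _ jn; rewrite !mul0r !subr0 !addr0; lra.
  have := IH (ltnW jn); rewrite /b (Sm j.+1) (Sp j.+1).
  by have := fj _ jn; rewrite Pm Pp; lra.
have b0 : b 0%N = 2 * f m by rewrite /b !mul0r subr0 addr0; ring.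
suff bk k : (k <= n)%N -> b 0%N <= b k by rewrite -b0; exact: bk.
elim: k => [//|k IH] kn; exact: le_trans (IH (ltnW kn)) (step _ kn).
Qed.

Definition circulant_discr (R : realFieldType) (l1 l2 l3 : R) : R :=
  l1 ^+ 2 + l2 ^+ 2 + l3 ^+ 2 - l1 * l2 - l2 * l3 - l3 * l1.

Lemma circulant_discr_gt0 (R : realFieldType) (l1 l2 l3 : R) :
  ~ (l1 = l2 /\ l2 = l3) -> 0 < circulant_discr l1 l2 l3.
Proof.
move=> l; have -> : circulant_discr l1 l2 l3 =
    ((l1 - l2) ^+ 2 + (l2 - l3) ^+ 2 + (l1 - l3) ^+ 2) / 2.
  by rewrite /circulant_discr; field.
have := sqr_ge0 (l1 - l2); have := sqr_ge0 (l2 - l3); have := sqr_ge0 (l1 - l3).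
have [e12|] := eqVneq l1 l2; last first.
  by rewrite -subr_eq0 -sqrf_eq0 => /eqP; lra.
have [e23|] := eqVneq l2 l3; first by case: l.
by rewrite -subr_eq0 -sqrf_eq0 => /eqP; lra.
Qed.

Lemma circulant_midpoint (R : realFieldType) (I : set R) (f : R -> R)
    (l1 l2 l3 p t : R) :
  is_interval I -> 0 <= l1 <= 1 -> 0 <= l2 <= 1 -> 0 <= l3 <= 1 ->
  l1 + l2 + l3 = 1 ->
  (forall x1 x2 x3 : R, I x1 -> I x2 -> I x3 ->
     f ((x1 + x2 + x3) / 3) <=
     1 / 3 * (f (l1 * x1 + l2 * x2 + l3 * x3)
              + f (l2 * x1 + l3 * x2 + l1 * x3)
              + f (l3 * x1 + l1 * x2 + l2 * x3))) ->
  0 <= t -> I (p - t) -> I (p + t) ->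
  let h := circulant_discr l1 l2 l3 * t in
  2 * f p <= f (p - h) + f (p + h).
Proof.
move=> Iitv hl1 hl2 hl3 hl fI t0 Im Ip; set h := _ * t => /=.
have Iw a : -1 <= a <= 1 -> I (p + a * t).
  by move=> a1; apply: Iitv Im Ip _ _; nra.
(* The circulant matrix maps [(l2 - l1, l3 - l2, l1 - l3) * t] to [(- h, h, 0)];
   this direction comes from the cofactors of the matrix. *)
have := fI (p + (l2 - l1) * t) (p + (l3 - l2) * t) (p + (l1 - l3) * t).
have sumlE a b : a = (l1 + l2 + l3) * p + b -> a = p + b by rewrite hl mul1r.
have -> : (p + (l2 - l1) * t + (p + (l3 - l2) * t) + (p + (l1 - l3) * t)) / 3 = p.
  by field.
rewrite [l1 * _ + _ + _](sumlE _ (- h)); last by rewrite /h /circulant_discr; ring.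
rewrite [l2 * _ + _ + _](sumlE _ h); last by rewrite /h /circulant_discr; ring.
rewrite [l3 * _ + _ + _](sumlE _ 0); last by ring.
rewrite addr0 => /(_ (Iw _ _) (Iw _ _) (Iw _ _)) fp.
suff : f p <= 1 / 3 * (f (p - h) + f (p + h) + f p) by lra.
by apply: fp; lra.
Qed.

(** Since [I] is open, there is [e > 0] such that all points within [e] of the
    segment [[x, y]] lie in [I]; steps up to [D e] are then admissible at every
    point of the segment, and half of the segment is cut into [n] of them. *)
Lemma jensen_convex_of_circulant (R : realType) (I : set R) (f : R -> R)
    (l1 l2 l3 : R) :
  open I -> is_interval I ->
  0 <= l1 <= 1 -> 0 <= l2 <= 1 -> 0 <= l3 <= 1 -> l1 + l2 + l3 = 1 ->
  ~ (l1 = l2 /\ l2 = l3) ->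
  (forall x1 x2 x3 : R, I x1 -> I x2 -> I x3 ->
     f ((x1 + x2 + x3) / 3) <=
     1 / 3 * (f (l1 * x1 + l2 * x2 + l3 * x3)
              + f (l2 * x1 + l3 * x2 + l1 * x3)
              + f (l3 * x1 + l1 * x2 + l2 * x3))) ->
  jensen_convex I f.
Proof.
move=> Iopen Iitv hl1 hl2 hl3 hl lneq fI x y.
wlog xy : x y / x <= y.
  move=> H Ix Iy; have [|/ltW] := leP x y => xy; first exact: H.
  by rewrite [x + y]addrC [f x + _]addrC; exact: H.
move=> Ix Iy.
have nbhsI z : I z -> exists2 e, 0 < e & forall u, `|z - u| < e -> I u.
  by move=> Iz; have /nbhs_ballP[e /= e0 ze] := open_nbhs_nbhs (conj Iopen Iz); exists e.
have [e1 e10 I1] := nbhsI _ Ix; have [e2 e20 I2] := nbhsI _ Iy.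
have [e [e0 Ixe Iye]] : exists e, [/\ 0 < e, I (x - e) & I (y + e)].
  exists (Num.min e1 e2 / 2).
  have m0 : 0 < Num.min e1 e2 by rewrite lt_min e10.
  have m1 : Num.min e1 e2 <= e1 by rewrite ge_min lexx.
  have m2 : Num.min e1 e2 <= e2 by rewrite ge_min lexx orbT.
  split; first by lra.
    by apply: I1; rewrite opprB addrC subrK gtr0_norm; lra.
  by apply: I2; rewrite opprD addrA subrr add0r normrN gtr0_norm; lra.
set D := circulant_discr l1 l2 l3.
have D0 : 0 < D := circulant_discr_gt0 lneq.
set h := (y - x) / 2.
have h0 : 0 <= h by rewrite /h; lra.
have [n n0 hn] : exists2 n : nat, 0 < n%:R :> R & h < n%:R * (D * e).
  have hDe : 0 <= h / (D * e) by rewrite divr_ge0 // ltW // mulr_gt0.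
  have hn := archi_boundP hDe; exists (Num.bound (h / (D * e))).
    exact: le_lt_trans hDe hn.
  by rewrite -ltr_pdivrMr // mulr_gt0.
have nd : n%:R * (h / n%:R) = h by rewrite mulrC divfK ?gt_eqF.
set d := h / n%:R in nd.
have d0 : 0 <= d by rewrite divr_ge0 // ltW.
have dDe : d <= D * e by rewrite /d ler_pdivrMr // mulrC ltW.
have fp p : x <= p <= y -> 2 * f p <= f (p - d) + f (p + d).
  move=> pxy.
  have te : 0 <= d / D <= e.
    by rewrite (divr_ge0 d0 (ltW D0)) ler_pdivrMr // mulrC.
  have dE : d = D * (d / D) by rewrite mulrC divfK ?gt_eqF.
  rewrite dE; apply: (circulant_midpoint Iitv hl1 hl2 hl3 hl fI); first by lra.
    by apply: Iitv Ixe Iye _ _; lra.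
  by apply: Iitv Ixe Iye _ _; lra.
have : 2 * f ((x + y) / 2) <=
    f ((x + y) / 2 - n%:R * d) + f ((x + y) / 2 + n%:R * d).
  apply: midpoint_of_small_steps => j jn.
  have jd : 0 <= j%:R * d <= h.
    by rewrite mulr_ge0 //= -nd ler_wpM2r // ler_nat ltnW.
  by split; apply: fp; move: jd; rewrite /h; lra.
rewrite nd; have -> : (x + y) / 2 - h = x by rewrite /h; field.
by have -> : (x + y) / 2 + h = y; [rewrite /h; field | lra].
Qed.

Theorem corollary3p6 (R : realType) (I : set R) (f : R -> R)
    (l1 l2 l3 : R)
    (I_neq0 : I !=set0) (I_open : open I) (I_itv : is_interval I)
    (hl1 : 0 <= l1 <= 1) (hl2 : 0 <= l2 <= 1) (hl3 : 0 <= l3 <= 1)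
    (hl : l1 + l2 + l3 = 1) :
  (((forall k : nat, k \in [:: 1%N; 2%N] ->
       \sum_(1 <= j < 4)
          ([:: l1; l2; l3]`_(j - 1))%:C * omega3 R ^+ (k * (j - 1)) != 0)
     <-> ~ (l1 = l2 /\ l2 = l3))
   /\ (~ (l1 = l2 /\ l2 = l3)
       <-> ~ (l1 = 1 / 3 /\ l2 = 1 / 3 /\ l3 = 1 / 3)))
  /\
  (~ (l1 = l2 /\ l2 = l3) ->
   (forall x1 x2 x3 : R, I x1 -> I x2 -> I x3 ->
      f ((x1 + x2 + x3) / 3) <=
      1 / 3 * (f (l1 * x1 + l2 * x2 + l3 * x3)
               + f (l2 * x1 + l3 * x2 + l1 * x3)
               + f (l3 * x1 + l1 * x2 + l2 * x3))) ->
   jensen_convex I f).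
Proof.
split; last exact: jensen_convex_of_circulant.
split; first exact: cubic_sums_neq0.
split=> ne H; apply: ne; first by case: H => -> [-> ->].
by case: H => e12 e23; repeat split; lra.
Qed.
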